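(* Let $N$ be a fixed positive integer and let $R$ be a computable POVM on $\Sigma^*$ (with values in $N\times N$ matrices). Then: (i) there exists $d\in\mathbb{N}$ such that for every density matrix $\rho\in\mathrm{Her}(N)$ and every $s\in\Sigma^*$, $$K(s)-d\le -\log_2 \operatorname{tr}(\rho R(s));$$ (ii) there exists a real $c>0$ such that for every density matrix $\rho\in\mathrm{Her}(N)$ and every $s\in\Sigma^*$, $$\operatorname{tr}(\rho R(s))\le c\,P(s).$$
   Context: $\Sigma^*=\{\lambda,0,1,00,01,\dots\}$ is the set of finite binary strings. $\mathrm{Her}(N)$ is the set of $N\times N$ complex Hermitian matrices; for $A,B\in\mathrm{Her}(N)$, $A\leqslant B$ means $B-A$ is positive semi-definite. A density matrix is $\rho\in\mathrm{Her}(N)$ with $0\leqslant\rho$ and $\operatorname{tr}\rho=1$. A semi-POVM on $\Sigma^*$ is a map $R:\Sigma^*\to\mathrm{Her}(N)$ with $0\leqslant R(s)$ for all $s$ and $\sum_{s\in\Sigma^*}R(s)\leqslant I$; it is a POVM on $\Sigma^*$ if moreover $\sum_{s}R(s)=I$. $\mathbb{C}_Q=\{a+ib: a,b\in\mathbb{Q}\}$. A map $F:\Sigma^*\to M_N(\mathbb{C})$ is computable if there is a total recursive $G:\Sigma^*\times\mathbb{N}\to M_N(\mathbb{C}_Q)$ with $\|F(s)-G(s,k)\|<2^{-k}$ (operator norm) for all $s,k$. A computer is a partial recursive function $C:\Sigma^*\to\Sigma^*$ whose domain is prefix-free; a computer $U$ is optimal if for every computer $C$ there is a constant $\mathrm{sim}(C)$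 such that whenever $C(p)$ is defined there is $p'$ with $U(p')=C(p)$ and $|p'|\le|p|+\mathrm{sim}(C)$. Fix an optimal computer $U$. $K(s)=\min\{|p|: U(p)=s\}$ (Kolmogorov complexity) and $P(s)=\sum_{U(p)=s}2^{-|p|}$. $-\log_2 0=\infty$. *)

(* Defs.v *)
From mathcomp Require Import all_boot all_order all_algebra.
From mathcomp Require Import all_classical all_reals all_analysis.
From mathcomp Require Export complex.
Set Implicit Arguments. Unset Strict Implicit. Unset Printing Implicit Defensive.
Import Order.TTheory GRing.Theory Num.Theory numFieldNormedType.Exports.
Local Open Scope classical_set_scope.
Local Open Scope ring_scope.

Inductive prf : Type :=
| PZero : prf
| PSucc : prf
| PProj : nat -> prf
| PComp : prf -> seq prf -> prf
| PRec  : prf -> prf -> prf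
| PMu   : prf -> prf.

Inductive eval : prf -> seq nat -> nat -> Prop :=
| eZero v : eval PZero v 0
| eSucc x v : eval PSucc (x :: v) x.+1
| eProj i v : (i < size v)%N -> eval (PProj i) v (nth 0%N v i)
| eComp f gs v ys y : evals gs v ys -> eval f ys y -> eval (PComp f gs) v y
| eRec0 f g v y : eval f v y -> eval (PRec f g) (0%N :: v) y
| eRecS f g n v r y : eval (PRec f g) (n :: v) r -> eval g (n :: r :: v) y ->
    eval (PRec f g) (n.+1 :: v) y
| eMu f v n : eval f (n :: v) 0 ->
    (forall m, (m < n)%N -> exists k, eval f (m :: v) k.+1) -> eval (PMu f) v n
with evals : seq prf -> seq nat -> seq nat -> Prop :=
| esNil v : evals [::] v [::]
| esCons g gs v y ys : eval g v y -> evals gs v ys -> evals (g :: gs) v (y :: ys).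

(* Binary strings Sigma^* = seq bool, coded bijectively by nat:
   s |-> (number with binary expansion 1s) - 1. *)
Definition str_code (s : seq bool) : nat :=
  (foldl (fun a (b : bool) => a.*2 + b) 1 s).-1.

Definition recursive2 (f : nat -> nat -> nat) : Prop :=
  exists c : prf, forall x k y, eval c [:: x; k] y <-> f x k = y.

Definition partial_recursive (C : seq bool -> option (seq bool)) : Prop :=
  exists c : prf, forall s y, eval c [:: str_code s] y <-> omap str_code (C s) = Some y.

Definition recursive_rat2 (g : seq bool -> nat -> rat) : Prop :=
  exists fa fb fc : nat -> nat -> nat,
    [/\ recursive2 fa, recursive2 fb, recursive2 fc &
        forall s k, g s k = ((fa (str_code s) k)%:R - (fb (str_code s) k)%:R)
                            / ((fc (str_code s) k).+1)%:R].

Definition computer (C : seq bool -> option (seq bool)) : Prop :=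
  partial_recursive C /\
  forall p q s t, C p = Some s -> C q = Some t -> prefix p q -> p = q.

Definition optimal_computer (U : seq bool -> option (seq bool)) : Prop :=
  computer U /\
  forall C, computer C -> exists sim : nat,
    forall p s, C p = Some s -> exists p', U p' = Some s /\ (size p' <= size p + sim)%N.

Section Quantum.
Variable R : realType.
Local Notation C := R[i].

(* Kolmogorov complexity K(s) (+oo if s has no program) and P(s) *)
Definition Kc (U : seq bool -> option (seq bool)) (s : seq bool) : \bar R :=
  ereal_inf [set ((size p)%:R)%:E | p in [set p | U p = Some s]].

Definition Pu (U : seq bool -> option (seq bool)) (s : seq bool) : \bar R :=
  (\esum_(p in [set p | U p = Some s]) (((2 : R) ^+ size p)^-1)%:E)%E.

Definition mlog2 (x : R) : \bar R :=
  if x == 0 then +oo%E else (- (ln x / ln 2))%:E.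

Variable N : nat.

Definition adjmx m n (A : 'M[C]_(m, n)) : 'M[C]_(n, m) := (map_mx conjc A)^T.

Definition hermitian (A : 'M[C]_N) : Prop := adjmx A = A.

Definition psd (A : 'M[C]_N) : Prop :=
  hermitian A /\ forall v : 'cV[C]_N, 0 <= (adjmx v *m A *m v) 0 0.

Definition mxle (A B : 'M[C]_N) : Prop := psd (B - A).

Definition density (rho : 'M[C]_N) : Prop := psd rho /\ \tr rho = 1.

Definition vnorm (v : 'cV[C]_N) : R :=
  Num.sqrt (\sum_i ((complex.Re (v i 0)) ^+ 2 + (complex.Im (v i 0)) ^+ 2)).

Definition opnorm (A : 'M[C]_N) : R :=
  sup [set vnorm (A *m v) | v in [set v | vnorm v = 1]].

Fixpoint strs_len (n : nat) : seq (seq bool) :=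
  if n is n'.+1 then [seq false :: s | s <- strs_len n'] ++ [seq true :: s | s <- strs_len n']
  else [:: [::]].

Definition strs_upto (n : nat) : seq (seq bool) := flatten [seq strs_len k | k <- iota 0 n].

Definition partial_sum (Rm : seq bool -> 'M[C]_N) (n : nat) : 'M[C]_N :=
  \sum_(s <- strs_upto n) Rm s.

(* semi-POVM: R(s) >= 0 and sum_s R(s) <= I (all finite partial sums <= I) *)
Definition semiPOVM (Rm : seq bool -> 'M[C]_N) : Prop :=
  (forall s, psd (Rm s)) /\ (forall n, mxle (partial_sum Rm n) 1%:M).

(* POVM: moreover sum_s R(s) = I (entrywise convergence of the partial sums) *)
Definition POVM (Rm : seq bool -> 'M[C]_N) : Prop :=
  semiPOVM Rm /\
  forall i j,
    complex.Re (partial_sum Rm n i j) @[n --> \oo] --> (complex.Re ((1%:M : 'M[C]_N) i j) : R) /\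
    complex.Im (partial_sum Rm n i j) @[n --> \oo] --> (complex.Im ((1%:M : 'M[C]_N) i j) : R).

Definition cq_mx (G : 'M[rat * rat]_N) : 'M[C]_N :=
  \matrix_(i, j) Complex (ratr (G i j).1) (ratr (G i j).2).

Definition computable_mx (F : seq bool -> 'M[C]_N) : Prop :=
  exists G : seq bool -> nat -> 'M[rat * rat]_N,
    (forall i j, recursive_rat2 (fun s k => (G s k i j).1) /\
                 recursive_rat2 (fun s k => (G s k i j).2)) /\
    forall s k, opnorm (F s - cq_mx (G s k)) < ((2 : R) ^+ k)^-1.

End Quantum.

(* Main.v *)
Require Import Defs.
From mathcomp Require Import all_boot all_order all_algebra.
From mathcomp Require Import all_classical all_reals all_analysis.
From mathcomp Require Import complex.
From mathcomp Require Import spectral sesquilinear.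
From mathcomp Require Import zify ring lra.
Import Order.TTheory GRing.Theory Num.Theory.
Local Open Scope ring_scope.

Set Implicit Arguments. Unset Strict Implicit. Unset Printing Implicit Defensive.

(** For a density matrix rho, tr (rho R(s)) <= tr R(s), and tr R(s) is a computable
    function of s with total mass at most N. Evaluating the n-th string with precision
    2^-n and rounding up gives a dyadic weight w(n) = A(n) / 2^(n + c) that dominates
    2^-c tr R(s_n) while sum_n w(n) <= 1. Lay consecutive intervals I_n of length w(n)
    in the unit interval and let a program p output s_n when the dyadic interval of p is
    a maximal one inside I_n. Maximality makes the domain prefix-free, n is found by
    unbounded search, and I_n contains a dyadic interval of length at least w(n) / 4.
    The optimal computer therefore has a program p for s with tr R(s) <= 2^d 2^-|p|,
    from which both claims are immediate. *)

(** * Total recursive functions *)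

Local Open Scope nat_scope.

Local Notation eval := Defs.eval.

(** Arities are handled with plain lists: the value of the code is prescribed only on lists of
    length [n], and arguments are read with [nth 0]. *)
Definition total_recursive (n : nat) (f : seq nat -> nat) : Prop :=
  exists c, forall v, size v = n -> eval c v (f v).

Lemma total_recursive_ext n f g : (forall v, size v = n -> f v = g v) ->
  total_recursive n f -> total_recursive n g.
Proof. by move=> fg [c hc]; exists c => v sv; rewrite -fg //; apply: hc. Qed.

Lemma total_recursive_nth n i : i < n -> total_recursive n (fun v => nth 0 v i).
Proof. by move=> lin; exists (PProj i) => v sv; apply: eProj; rewrite sv. Qed.

Lemma total_recursive_comp n m f (g : nat -> seq nat -> nat) :
  total_recursive m f -> (forall i, i < m -> total_recursive n (g i)) ->
  total_recursive n (fun v => f (mkseq (g^~ v) m)).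
Proof.
move=> [c hc] hg.
have [gs hgs] : exists gs, forall v, size v = n -> evals gs v (mkseq (g^~ v) m).
  elim: m {hc} g hg => [|m IH] g hg; first by exists [::] => v _; apply: esNil.
  have [gs hgs] := IH (fun i => g i.+1) (fun i lim => hg i.+1 lim).
  have [c0 hc0] := hg 0 isT.
  exists (c0 :: gs) => v sv; rewrite /mkseq /= -[1]addn0 iotaDl -map_comp.
  by apply: esCons; [exact: hc0 | exact: hgs].
exists (PComp c gs) => v sv; apply: eComp (hgs _ sv) (hc _ _).
by rewrite size_mkseq.
Qed.

Lemma total_recursive_comp1 n f g : total_recursive 1 f -> total_recursive n g ->
  total_recursive n (fun v => f [:: g v]).
Proof. by move=> hf hg; apply: (total_recursive_comp (g := fun=> g) hf). Qed.

Lemma total_recursive_comp2 n f g h :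
  total_recursive 2 f -> total_recursive n g -> total_recursive n h ->
  total_recursive n (fun v => f [:: g v; h v]).
Proof.
move=> hf hg hh.
by apply: (total_recursive_comp (g := fun i => if i is 0 then g else h) hf) => -[].
Qed.

(** Weakening: the step function of a recursion receives two extra leading arguments, the counter
    and the previous value, and must still reach the parameters. *)
Lemma total_recursive_drop n m f : total_recursive n f ->
  total_recursive (m + n) (fun w => f (drop m w)).
Proof.
move=> hf; apply: (@total_recursive_ext _ (fun w => f (mkseq (fun i => nth 0 w (m + i)) n))).
  move=> w sw; congr f; apply: (@eq_from_nth _ 0).
    by rewrite size_mkseq size_drop sw addKn.
  by move=> i; rewrite size_mkseq => lin; rewrite nth_mkseq // nth_drop.
apply: (total_recursive_comp (g := fun i w => nth 0 w (m + i)) hf) => i lin.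
by apply: total_recursive_nth; rewrite ltn_add2l.
Qed.

Lemma total_recursive_S n f : total_recursive n f -> total_recursive n (fun v => (f v).+1).
Proof.
move=> hf; apply: (total_recursive_comp1 (f := fun v => (nth 0 v 0).+1) _ hf).
by exists PSucc => -[|x [|]] // _; apply: eSucc.
Qed.

Lemma total_recursive_const n k : total_recursive n (fun=> k).
Proof.
elim: k => [|k]; first by exists PZero => v _; apply: eZero.
exact: total_recursive_S.
Qed.

Lemma total_recursive_rec n f h g :
  total_recursive n f -> total_recursive n h -> total_recursive n.+2 g ->
  total_recursive n (fun v => nat_rect (fun=> nat) (f v) (fun k r => g [:: k, r & v]) (h v)).
Proof.
move=> [cf hf] hh [cg hg].
pose F w := nat_rect (fun=> nat) (f (drop 1 w))
  (fun k r => g [:: k, r & drop 1 w]) (nth 0 w 0).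
have hF : total_recursive n.+1 F.
  exists (PRec cf cg) => -[|x v] //= [sv]; rewrite /F /= drop0.
  elim: x => [|x IH] /=; first by apply: eRec0; apply: hf.
  by apply: eRecS IH _; apply: hg; rewrite /= sv.
(* [PRec] recurses on the head of its argument list, so the counter [h v] is put in front of the
   parameters. *)
pose G i (v : seq nat) := if i is j.+1 then nth 0 v j else h v.
apply: (@total_recursive_ext _ (fun v => F (mkseq (G^~ v) n.+1))).
  move=> v sv; have -> : mkseq (G^~ v) n.+1 = h v :: v.
    rewrite /mkseq /= -[1]addn0 iotaDl -map_comp; congr cons.
    by rewrite -sv; apply: mkseq_nth.
  by rewrite /F /= drop0.
apply: total_recursive_comp hF _ => -[|i] // lin.
exact: total_recursive_nth.
Qed.

Lemma total_recursive_prec n f h (g : nat -> nat -> seq nat -> nat) :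
  total_recursive n f -> total_recursive n h ->
  total_recursive n.+2 (fun w => g (nth 0 w 0) (nth 0 w 1) (drop 2 w)) ->
  total_recursive n (fun v => nat_rect (fun=> nat) (f v) (fun k r => g k r v) (h v)).
Proof.
move=> hf hh hg; have := total_recursive_rec hf hh hg.
by apply: total_recursive_ext => v sv /=; rewrite drop0.
Qed.

Lemma total_recursive_add n f g : total_recursive n f -> total_recursive n g ->
  total_recursive n (fun v => f v + g v).
Proof.
move=> hf hg.
apply: total_recursive_ext (total_recursive_prec (g := fun _ r _ => r.+1) hf hg _).
  by move=> v _; elim: (g v) => [|k IH] /=; [rewrite addn0|rewrite IH addnS].
by apply: total_recursive_S; apply: total_recursive_nth.
Qed.

Lemma total_recursive_mul n f g : total_recursive n f -> total_recursive n g ->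
  total_recursive n (fun v => f v * g v).
Proof.
move=> hf hg.
apply: total_recursive_ext (total_recursive_prec
  (g := fun _ r v => r + f v) (total_recursive_const n 0) hg _).
  by move=> v _; elim: (g v) => [|k IH] /=; [rewrite muln0|rewrite IH mulnSr].
apply: total_recursive_add; first exact: total_recursive_nth.
exact: (@total_recursive_drop _ 2).
Qed.

Lemma total_recursive_pred n f : total_recursive n f -> total_recursive n (fun v => (f v).-1).
Proof.
move=> hf.
apply: total_recursive_ext (total_recursive_prec
  (g := fun k _ _ => k) (total_recursive_const n 0) hf _).
  by move=> v _; case: (f v).
exact: total_recursive_nth.
Qed.

Lemma total_recursive_sub n f g : total_recursive n f -> total_recursive n g ->
  total_recursive n (fun v => f v - g v).
Proof.
move=> hf hg.
apply: total_recursive_ext (total_recursive_prec (g := fun _ r _ => r.-1) hf hg _).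
  by move=> v _; elim: (g v) => [|k IH] /=; [rewrite subn0|rewrite IH subnS].
by apply: total_recursive_pred; apply: total_recursive_nth.
Qed.

Lemma total_recursive_pow2 n f : total_recursive n f -> total_recursive n (fun v => 2 ^ f v).
Proof.
move=> hf.
apply: total_recursive_ext (total_recursive_prec
  (g := fun _ r _ => r + r) (total_recursive_const n 1) hf _).
  by move=> v _; elim: (f v) => [|k IH] //=; rewrite IH expnS mul2n addnn.
by apply: total_recursive_add; apply: total_recursive_nth.
Qed.

(** Predicates are 0/1-valued functions through the coercion from [bool]; negation is [1 - f]. *)
Lemma total_recursive_not n (f : seq nat -> bool) :
  total_recursive n f -> total_recursive n (fun v => ~~ f v).
Proof.
move=> hf; have := total_recursive_sub (total_recursive_const n 1) hf.
by apply: total_recursive_ext => v _; case: (f v).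
Qed.

Lemma total_recursive_and n (f g : seq nat -> bool) :
  total_recursive n f -> total_recursive n g -> total_recursive n (fun v => f v && g v).
Proof.
move=> hf hg; have := total_recursive_mul hf hg.
by apply: total_recursive_ext => v _; case: (f v); case: (g v).
Qed.

Lemma total_recursive_leq n f g : total_recursive n f -> total_recursive n g ->
  total_recursive n (fun v => f v <= g v).
Proof.
move=> hf hg; have := total_recursive_sub (total_recursive_const n 1)
  (total_recursive_sub hf hg).
apply: total_recursive_ext => v _; rewrite /leq.
by case: (f v - g v).
Qed.

(** Recursion on the dividend: the quotient [r] of [k] grows by one at [k.+1] exactly when [r.+1]
    times the divisor still fits into [k.+1]. *)
Lemma total_recursive_div n f g : total_recursive n f -> total_recursive n g ->
  total_recursive n (fun v => f v %/ (g v).+1).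
Proof.
move=> hf hg.
apply: total_recursive_ext (total_recursive_prec
  (g := fun k r v => r + (r.+1 * (g v).+1 <= k.+1)) (total_recursive_const n 0) hf _).
  move=> v _; elim: (f v) => [|k IH] /=; first by rewrite div0n.
  rewrite IH; move: (g v) => d {IH}.
  apply/eqP; rewrite eqn_leq leq_divRL // -[X in _ && X]ltnS ltn_divLR //.
  have := ltn_ceil k (ltn0Sn d); have := leq_trunc_div k d.+1.
  case: leqP => h h1 h2; apply/andP; split; lia.
apply: total_recursive_add; first exact: total_recursive_nth.
apply: total_recursive_leq; last by apply: total_recursive_S; apply: total_recursive_nth.
apply: total_recursive_mul; apply: total_recursive_S; first exact: total_recursive_nth.
exact: (@total_recursive_drop _ 2).
Qed.

Lemma total_recursive_sum n (I : Type) (r : seq I) (F : I -> seq nat -> nat) :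
  (forall i, total_recursive n (F i)) -> total_recursive n (fun v => \sum_(i <- r) F i v).
Proof.
move=> hF; elim: r => [|i r IH].
  by apply: total_recursive_ext (total_recursive_const n 0) => v _; rewrite big_nil.
have := total_recursive_add (hF i) IH.
by apply: total_recursive_ext => v _; rewrite big_cons.
Qed.

(** The current power [r] of two is doubled as soon as [2 * r] no longer exceeds the argument. *)
Lemma total_recursive_trunc_pow n f : total_recursive n f ->
  total_recursive n (fun v => 2 ^ trunc_log 2 (f v).+1).
Proof.
move=> hf.
apply: total_recursive_ext (total_recursive_prec
  (g := fun k r _ => r + r * (r + r <= k.+2)) (total_recursive_const n 1) hf _).
  move=> v _; elim: (f v) => [|k IH] //=; rewrite IH.
  have /andP[h1 h2] := trunc_log_bounds (isT : 1 < 2) (isT : 0 < k.+1).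
  set l := trunc_log 2 k.+1 in h1 h2 *.
  case: leqP => h /=.
    rewrite muln1 addnn -mul2n -expnS; congr expn; apply/esym/trunc_log_eq => //.
    by move: h2 h; rewrite !expnS => h2 h; apply/andP; split; lia.
  rewrite muln0 addn0; congr expn; apply/esym/trunc_log_eq => //.
  by move: h; rewrite !expnS => h; apply/andP; split; lia.
apply: total_recursive_add; first exact: total_recursive_nth.
apply: total_recursive_mul; first exact: total_recursive_nth.
apply: total_recursive_leq; first by apply: total_recursive_add; apply: total_recursive_nth.
by do 2 apply: total_recursive_S; apply: total_recursive_nth.
Qed.

Lemma total_recursive_recursive2 n f g h :
  recursive2 f -> total_recursive n g -> total_recursive n h ->
  total_recursive n (fun v => f (g v) (h v)).
Proof.
move=> [c hc] hg hh.
apply: (total_recursive_comp2 (f := fun w => f (nth 0 w 0) (nth 0 w 1)) _ hg hh).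
by exists c => -[|x [|y [|]]] //= _; apply/hc.
Qed.

(** * Determinism of evaluation and unbounded search *)

(** The codes below a [PComp] are nested in a list; the inner fixpoint supplies an induction
    hypothesis for each of them. *)
Fixpoint prf_nested_ind (P : prf -> Prop) (H0 : P PZero) (HS : P PSucc)
    (Hp : forall i, P (PProj i))
    (Hc : forall f gs, P f -> List.Forall P gs -> P (PComp f gs))
    (Hr : forall f g, P f -> P g -> P (PRec f g))
    (Hm : forall f, P f -> P (PMu f)) (c : prf) : P c :=
  let IH := prf_nested_ind H0 HS Hp Hc Hr Hm in
  match c with
  | PZero => H0
  | PSucc => HS
  | PProj i => Hp i
  | PComp f gs => Hc _ _ (IH f)
      ((fix all gs : List.Forall P gs :=
          if gs is g :: gs' then List.Forall_cons _ (IH g) (all gs')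
          else List.Forall_nil P) gs)
  | PRec f g => Hr _ _ (IH f) (IH g)
  | PMu f => Hm _ (IH f)
  end.

Lemma eval_comp_inv f gs v y : eval (PComp f gs) v y ->
  exists2 ys, evals gs v ys & eval f ys y.
Proof. by inversion 1; exists ys. Qed.

Lemma evals_cons_inv g gs v zs : evals (g :: gs) v zs ->
  exists y ys, [/\ zs = y :: ys, eval g v y & evals gs v ys].
Proof. by inversion 1; exists y, ys. Qed.

Lemma eval_rec0_inv f g v y : eval (PRec f g) (0 :: v) y -> eval f v y.
Proof. by inversion 1. Qed.

Lemma eval_recS_inv f g n v y : eval (PRec f g) (n.+1 :: v) y ->
  exists2 r, eval (PRec f g) (n :: v) r & eval g [:: n, r & v] y.
Proof. by inversion 1; exists r. Qed.

Lemma eval_mu_inv f v n : eval (PMu f) v n ->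
  eval f (n :: v) 0 /\ forall m, m < n -> exists k, eval f (m :: v) k.+1.
Proof. by inversion 1. Qed.

(** In the [PMu] case the smaller of two distinct results would make the body evaluate both to 0 and
    to a successor. *)
Lemma eval_fun c v y y' : eval c v y -> eval c v y' -> y = y'.
Proof.
move: c v y y'; elim/prf_nested_ind.
- by move=> v y y'; inversion 1; inversion 1.
- by move=> v y y'; inversion 1; subst; inversion 1.
- by move=> i v y y'; inversion 1; inversion 1.
- move=> f gs IHf IHgs v y y' /eval_comp_inv[ys hys hy] /eval_comp_inv[ys' hys' hy'].
  suff E : ys = ys' by rewrite -E in hy'; exact: IHf hy hy'.
  elim: IHgs ys ys' hys hys' {hy hy'} => [|g gs' IHg _ IH] ys ys'.
    by inversion 1; inversion 1.
  move=> /evals_cons_inv[z [zs [-> hz hzs]]] /evals_cons_inv[z' [zs' [-> hz' hzs']]].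
  by congr cons; [exact: IHg hz hz' | exact: IH hzs hzs'].
- move=> f g IHf IHg [|n v] y y'; first by inversion 1.
  elim: n y y' => [|n IHn] y y'.
    by move=> /eval_rec0_inv hy /eval_rec0_inv; exact: IHf hy.
  move=> /eval_recS_inv[r hr hy] /eval_recS_inv[r' hr' hy'].
  by rewrite -(IHn _ _ hr hr') in hy'; exact: IHg hy hy'.
- move=> f IHf v y y' /eval_mu_inv[hy ly] /eval_mu_inv[hy' ly'].
  case: (ltngtP y y') => // lt.
    by have [k hk] := ly' _ lt; have := IHf _ _ _ hy hk.
  by have [k hk] := ly _ lt; have := IHf _ _ _ hy' hk.
Qed.

(** [PMu] looks for a zero, so it is applied to the negation of [D]. Determinism gives the direction
    from a halting evaluation back to [D]. *)
Lemma partial_recursive_search (D : nat -> nat -> bool)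
    (C : seq bool -> option (seq bool)) :
  total_recursive 2 (fun v => D (nth 0 v 0) (nth 0 v 1)) ->
  (forall p n, omap str_code (C p) = Some n <->
     D n (str_code p) /\ forall m, m < n -> ~~ D m (str_code p)) ->
  partial_recursive C.
Proof.
move=> /total_recursive_not [c hc] CD; exists (PMu c) => p y.
have hc' n : eval c [:: n; str_code p] (~~ D n (str_code p)) by apply: (hc [:: n; _]).
split.
  move=> /eval_mu_inv[hy ly]; apply/CD; split.
    by have := eval_fun hy (hc' y); case: (D y _).
  move=> m lmy; have [k hk] := ly _ lmy.
  by have := eval_fun hk (hc' m); case: (D m _).
move=> /CD[Dy Dm]; apply: eMu.
  by have := hc' y; rewrite Dy.
by move=> m lmy; exists 0; have := hc' m; rewrite Dm.
Qed.

(** * Shannon-Fano coding of recursive dyadic weights *)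

(** The leading 1 records the length of [s], and [strnum s / 2 ^ size s] is the left end of the
    dyadic interval of [s], shifted by 1. *)
Definition strnum (s : seq bool) : nat := foldl (fun a (b : bool) => a.*2 + b) 1 s.

Lemma strnum_rcons s (b : bool) : strnum (rcons s b) = (strnum s).*2 + b.
Proof. by rewrite /strnum foldl_rcons. Qed.

Lemma strnum_bounds s : 2 ^ size s <= strnum s < 2 ^ (size s).+1.
Proof.
elim/last_ind: s => [|s b]; first by [].
by rewrite strnum_rcons size_rcons !expnS; case: b => /=; lia.
Qed.

Lemma strnum_gt0 s : 0 < strnum s.
Proof. by have /andP[+ _] := strnum_bounds s; apply: leq_trans; rewrite expn_gt0. Qed.

Lemma strnumE s : strnum s = (str_code s).+1.
Proof. by rewrite /str_code prednK // strnum_gt0. Qed.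

Lemma trunc_log_strnum s : trunc_log 2 (strnum s) = size s.
Proof. by apply: trunc_log_eq => //; apply: strnum_bounds. Qed.

Lemma strnum_half s b : (strnum (rcons s b)) %/ 2 = strnum s.
Proof. by rewrite strnum_rcons; case: b => /=; lia. Qed.

Lemma strnum_inj : injective strnum.
Proof.
elim/last_ind => [|s b IH] t; case/lastP: t => [|t a] //.
- by rewrite strnum_rcons; have := strnum_gt0 t; rewrite /strnum /=; lia.
- by rewrite strnum_rcons; have := strnum_gt0 s; rewrite /strnum /=; lia.
rewrite !strnum_rcons => E; have Eh : strnum s = strnum t by case: a b E => [] [] /=; lia.
by rewrite (IH _ Eh) in E *; congr rcons; case: a b E => [] [] /=; lia.
Qed.

Lemma str_code_inj : injective str_code.
Proof. by move=> s t E; apply: strnum_inj; rewrite !strnumE E. Qed.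

Lemma strnum_surj x : 0 < x -> exists s, strnum s = x.
Proof.
elim/ltn_ind: x => x IH x_gt0; case: (leqP x 1) => hx.
  by exists [::]; rewrite /strnum /=; lia.
have [||s hs] := IH (x %/ 2); [lia|lia|].
exists (rcons s (odd x)); rewrite strnum_rcons hs; lia.
Qed.

Lemma str_code_surj n : exists s, str_code s == n.
Proof.
have [s hs] := strnum_surj (ltn0Sn n).
by exists s; apply/eqP; apply: succn_inj; rewrite -strnumE.
Qed.

(** Serves only to enumerate the strings; recursiveness is stated on codes, so no program computes
    it. *)
Definition str_decode n : seq bool := xchoose (str_code_surj n).

Lemma str_decodeK : cancel str_decode str_code.
Proof. by move=> n; apply/eqP; apply: (xchooseP (str_code_surj n)). Qed.

Lemma str_codeK : cancel str_code str_decode.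
Proof. by move=> s; apply: str_code_inj; rewrite str_decodeK. Qed.

Section ShannonFano.
Variables (A : nat -> nat) (c : nat).

(* [left_end n / 2 ^ (n + c)] is the left endpoint of the n-th interval
   [1 + sum_(m < n) A m / 2 ^ (m + c)]; the shift by 1 matches the leading 1 of [strnum]. *)
Fixpoint left_end n := if n is m.+1 then 2 * (left_end m + A m) else 2 ^ c.

(* The dyadic interval of length [2 ^ -l] starting at [x / 2 ^ l], where
   [2 ^ l <= x < 2 ^ l.+1], lies inside the n-th interval. *)
Definition inside n x :=
  (left_end n * 2 ^ trunc_log 2 x <= x * 2 ^ (n + c)) &&
  (x.+1 * 2 ^ (n.+1 + c) <= left_end n.+1 * 2 ^ trunc_log 2 x).

(** Here [k] is the code of a string, [k.+1] its [strnum], and [k.+1 %/ 2] the [strnum] of the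
    string without its last bit. The test [0 < k] exempts the empty string, which has no last
    bit. *)
Definition maximal_inside n k :=
  inside n k.+1 && ~~ ((0 < k) && inside n (k.+1 %/ 2)).

Lemma left_end_ge n : 2 ^ (n + c) <= left_end n.
Proof. by elim: n => [|n IH] //=; rewrite addSn expnS; lia. Qed.

Lemma left_end_mono n m : n <= m -> left_end n * 2 ^ (m + c) <= left_end m * 2 ^ (n + c).
Proof.
elim: m => [|m IH]; first by rewrite leqn0 => /eqP->.
rewrite leq_eqVlt => /orP[/eqP->//|]; rewrite ltnS => /IH h.
by rewrite /= addSn expnS; nia.
Qed.

Lemma inside_uniq n m x : 0 < x -> inside n x -> inside m x -> n = m.
Proof.
move=> x_gt0; wlog lt_nm : n m / n < m => [W|].
  by case: (ltngtP n m) => // h hn hm; [exact: W | symmetry; exact: W].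
move=> /andP[_ hn] /andP[hm _]; have := left_end_mono lt_nm.
set l := 2 ^ trunc_log 2 x in hn hm *; move: hn hm.
have : 0 < 2 ^ (n.+1 + c) by rewrite expn_gt0.
have : 0 < 2 ^ (m + c) by rewrite expn_gt0.
have : 0 < l by rewrite expn_gt0.
move: (2 ^ (n.+1 + c)) (2 ^ (m + c)) (left_end n.+1) (left_end m) => a b u v.
move=> l0 b0 a0 h1 h2 h3; exfalso.
(* With denominators cleared, this is the impossible chain [x.+1 / l <= u / a <= v / b <= x / l]. *)
have h4 : u * l * b <= v * l * a by nia.
have h5 : x.+1 * a * b <= u * l * b by rewrite leq_mul2r h1 orbT.
have h6 : v * l * a <= x * b * a by rewrite leq_mul2r h2 orbT.
nia.
Qed.

(** Appending a bit selects one half of the dyadic interval. *)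
Lemma inside_rcons n p b : inside n (strnum p) -> inside n (strnum (rcons p b)).
Proof.
rewrite /inside !trunc_log_strnum strnum_rcons size_rcons => /andP[h1 h2].
by rewrite expnS; apply/andP; split; case: b; move: h1 h2 => /=; nia.
Qed.

Lemma inside_cat n p r : inside n (strnum p) -> inside n (strnum (p ++ r)).
Proof.
move=> h; elim/last_ind: r => [|r b IH]; first by rewrite cats0.
by rewrite -rcons_cat; apply: inside_rcons.
Qed.

(** The interval of [q] lies in that of [p], so [n = m]. Were [p] a proper prefix, [q] without its
    last bit would still extend [p] and be inside, against the maximality of [q]. *)
Lemma maximal_inside_prefix n m p q : maximal_inside n (str_code p) ->
  maximal_inside m (str_code q) -> prefix p q -> p = q.
Proof.
rewrite /maximal_inside -!strnumE => /andP[inp _] /andP[inq maxq] /prefixP[r E].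
case/lastP: r E => [|r b] E; first by rewrite E cats0.
have Enm : m = n.
  by apply: inside_uniq (strnum_gt0 q) inq _; rewrite E inside_cat.
move: maxq; rewrite E -rcons_cat strnum_half Enm inside_cat // andbT -leqNgt.
have := strnumE (rcons (p ++ r) b); rewrite strnum_rcons.
by have := strnum_gt0 (p ++ r); case: (str_code _) => [|k] //; case: (strnum _).
Qed.

Lemma maximal_inside_exists n p : inside n (strnum p) ->
  exists2 q, size q <= size p & maximal_inside n (str_code q).
Proof.
elim/last_ind: p => [|p b IH] h.
  by exists [::]; rewrite // /maximal_inside -strnumE h.
case: (boolP (inside n (strnum p))) => [/IH[q hq mq]|h'].
  by exists q => //; rewrite size_rcons ltnW.
exists (rcons p b) => //.
by rewrite /maximal_inside -strnumE h strnum_half (negbTE h') andbF.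
Qed.

Hypothesis A_gt0 : forall n, 0 < A n.
Hypothesis left_end_le : forall n, left_end n <= 2 ^ (n + c).+1.

(** Take the least [l] for which the n-th interval has length at least [2 / 2 ^ l]. A dyadic
    interval of length [2 ^ -l] then fits, and minimality bounds the length by [4 / 2 ^ l]. *)
Lemma inside_exists n : exists2 p, inside n (strnum p) & A n * 2 ^ size p <= 4 * 2 ^ (n + c).
Proof.
have ex_l : exists l, 2 * 2 ^ (n + c) <= A n * 2 ^ l.
  exists (n + c).+1; rewrite -expnS; exact: leq_pmull.
case: (ex_minnP ex_l) => l hl minl.
have hA : A n * 2 ^ l <= 4 * 2 ^ (n + c).
  (* For [l = 0] there is no smaller exponent to refute; the bound comes from the intervals lying
     between 1 and 2. *)
  case: l hl minl => [|l] hl minl.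
    have := left_end_le n.+1; have := left_end_ge n.
    by rewrite addSn !expnS /=; lia.
  have : ~~ (2 * 2 ^ (n + c) <= A n * 2 ^ l).
    by apply/negP => /minl; rewrite ltnn.
  by rewrite expnS; lia.
have P0 : 0 < 2 ^ (n + c) by rewrite expn_gt0.
(* the least multiple of [2 ^ -l] above the left endpoint *)
pose x := (left_end n * 2 ^ l + (2 ^ (n + c)).-1) %/ 2 ^ (n + c).
have x1 : left_end n * 2 ^ l <= x * 2 ^ (n + c).
  by have := ltn_ceil (left_end n * 2 ^ l + (2 ^ (n + c)).-1) P0; rewrite -/x; lia.
have x2 : x * 2 ^ (n + c) < left_end n * 2 ^ l + 2 ^ (n + c).
  by have := leq_trunc_div (left_end n * 2 ^ l + (2 ^ (n + c)).-1) (2 ^ (n + c)); rewrite -/x; lia.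
(* Rounding up costs less than one unit [2 ^ -l] and the dyadic interval takes one more; by [hl] the
   n-th interval is at least two units long. *)
have x3 : x.+1 * 2 ^ (n.+1 + c) <= left_end n.+1 * 2 ^ l.
  by rewrite /= addSn expnS; nia.
(* These two bounds give [x] exactly [l.+1] binary digits, so it is the [strnum] of a string of
   length [l]. *)
have x_ge : 2 ^ l <= x.
  rewrite -(leq_pmul2r P0); apply: leq_trans x1.
  by rewrite mulnC leq_mul2r left_end_ge orbT.
have x_lt : x < 2 ^ l.+1.
  rewrite -(@ltn_pmul2r (2 ^ (n.+1 + c))) ?expn_gt0 //.
  have := leq_trans x3 (leq_mul (left_end_le n.+1) (leqnn (2 ^ l))).
  have := expn_gt0 2 (n.+1 + c); rewrite !expnS /=; nia.
have [p hp] : exists p, strnum p = x.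
  by apply: strnum_surj; apply: leq_trans x_ge; rewrite expn_gt0.
have sp : size p = l.
  by rewrite -trunc_log_strnum hp; apply: trunc_log_eq; rewrite ?x_ge.
by exists p; rewrite ?sp // /inside trunc_log_strnum hp sp x1.
Qed.

Lemma total_recursive_left_end n f :
  total_recursive 1 (fun v => A (nth 0 v 0)) -> total_recursive n f ->
  total_recursive n (fun v => left_end (f v)).
Proof.
move=> hA hf.
apply: total_recursive_ext (total_recursive_prec
  (g := fun k r _ => 2 * (r + A k)) (total_recursive_const n (2 ^ c)) hf _).
  by move=> v _; elim: (f v) => [|k IH] //=; rewrite IH.
apply: total_recursive_mul; first exact: total_recursive_const.
apply: total_recursive_add; first exact: total_recursive_nth.
by apply: (total_recursive_comp1 (f := fun v => A (nth 0 v 0)) hA); apply: total_recursive_nth.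
Qed.

Lemma total_recursive_inside n f g :
  total_recursive 1 (fun v => A (nth 0 v 0)) ->
  total_recursive n f -> total_recursive n g ->
  total_recursive n (fun v => inside (f v) (g v).+1).
Proof.
move=> hA hf hg; have hG := total_recursive_trunc_pow hg.
have hc := total_recursive_const n c.
apply: total_recursive_and; apply: total_recursive_leq; apply: total_recursive_mul => //.
- exact: total_recursive_left_end.
- exact: total_recursive_S.
- by apply: total_recursive_pow2; apply: total_recursive_add.
- by do 2 apply: total_recursive_S.
- by apply: total_recursive_pow2; apply: total_recursive_add => //; apply: total_recursive_S.
- by apply: total_recursive_left_end => //; apply: total_recursive_S.
Qed.

Lemma total_recursive_maximal_inside :
  total_recursive 1 (fun v => A (nth 0 v 0)) ->
  total_recursive 2 (fun v => maximal_inside (nth 0 v 0) (nth 0 v 1)).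
Proof.
move=> hA.
have h0 : total_recursive 2 (fun v => nth 0 v 0) by apply: total_recursive_nth.
have h1 : total_recursive 2 (fun v => nth 0 v 1) by apply: total_recursive_nth.
apply: total_recursive_and; first exact: total_recursive_inside.
apply: total_recursive_not.
pose half v := ((nth 0 v 1).+1 %/ 2).-1.
have hhalf : total_recursive 2 half.
  apply: total_recursive_pred; apply: (total_recursive_div (g := fun=> 1)).
    exact: total_recursive_S.
  exact: total_recursive_const.
apply: (@total_recursive_ext _ (fun v => (1 <= nth 0 v 1) && inside (nth 0 v 0) (half v).+1)).
  move=> v _; rewrite /half; case: (nth 0 v 1) => [|k] //=.
  by rewrite prednK // divn_gt0.
apply: total_recursive_and; last exact: total_recursive_inside.
by apply: total_recursive_leq => //; apply: total_recursive_const.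
Qed.

Lemma shannon_fano_computer : total_recursive 1 (fun v => A (nth 0 v 0)) ->
  exists2 C, computer C & forall s, exists2 p, C p = Some s &
    A (str_code s) * 2 ^ size p <= 4 * 2 ^ (str_code s + c).
Proof.
move=> hA.
(* Defined classically; as the index [n] is unique, it is also the one that unbounded search
   finds. *)
pose C p := if pselect (exists n, maximal_inside n (str_code p)) is left h
  then Some (str_decode (ex_minn h)) else None.
have uniqD p n m : maximal_inside n (str_code p) -> maximal_inside m (str_code p) -> n = m.
  by move=> /andP[hn _] /andP[hm _]; apply: inside_uniq hn hm.
have CP p n : omap str_code (C p) = Some n <-> maximal_inside n (str_code p).
  rewrite /C; case: pselect => [h|h] /=; last by split=> // hn; case: h; exists n.
  case: ex_minnP => m hm _; rewrite str_decodeK; split=> [[<-]//|hn].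
  by congr Some; apply: uniqD hm hn.
exists C; first split.
- apply: (partial_recursive_search (total_recursive_maximal_inside hA)) => p n.
  rewrite CP; split=> [hn|[]//]; split=> // m lt_mn; apply/negP => hm.
  by rewrite (uniqD _ _ _ hm hn) ltnn in lt_mn.
- move=> p q s t hp hq.
  have /CP mp : omap str_code (C p) = Some (str_code s) by rewrite hp.
  have /CP mq : omap str_code (C q) = Some (str_code t) by rewrite hq.
  exact: maximal_inside_prefix mp mq.
move=> s; have [q inq hq] := inside_exists (str_code s).
have [p hp /CP mp] := maximal_inside_exists inq.
exists p; last by apply: leq_trans hq; rewrite leq_mul2l leq_pexp2l ?orbT.
by case E: (C p) mp => [t|] //= [/str_code_inj->].
Qed.

End ShannonFano.

Local Open Scope ring_scope.

(** * Positive semi-definite matrices *)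

Section PsdTrace.
Variables (R : realType) (N : nat).
Local Notation C := R[i].
Local Open Scope sesquilinear_scope.
Implicit Types A B : 'M[C]_N.

Lemma adjmxE m n (A : 'M[C]_(m, n)) : adjmx A = A ^t*.
Proof. by apply/matrixP => i j; rewrite !mxE. Qed.

(** A Hermitian matrix is normal, hence unitarily diagonalizable; [d 0 i] is the value of the
    quadratic form at the conjugate transpose of row [i] of [P]. *)
Lemma psd_spectral A : psd A -> exists P : 'M[C]_N, exists d : 'rV[C]_N,
  [/\ P \is unitarymx, A = P^t* *m diag_mx d *m P & forall i, 0 <= d 0 i].
Proof.
move=> [hA posA]; pose P := spectralmx A; pose d := spectral_diag A.
have uP : P \is unitarymx := spectral_unitarymx A.
have AE : A = P^t* *m diag_mx d *m P.
  rewrite -invmx_unitary //; apply/orthomx_spectralP; apply: hermitian_normalmx.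
  by apply/is_hermitianmxP; rewrite expr0 scale1r -adjmxE hA.
exists P, d; split=> // i.
have /unitarymxP PP := uP.
have PAP : P *m A *m P^t* = diag_mx d.
  by rewrite AE !mulmxA PP mul1mx -mulmxA PP mulmx1.
have := posA ((row i P)^t*); rewrite adjmxE trmxCK.
suff -> : (row i P *m A *m (row i P)^t*) 0 0 = d 0 i by [].
have <- : (P *m A *m P^t*) i i = d 0 i by rewrite PAP mxE eqxx mulr1n.
by rewrite -row_mul !mxE; apply: eq_bigr => k _; rewrite !mxE.
Qed.

Lemma unitarymx_normsq_le1 (W : 'M[C]_N) i j : W \is unitarymx -> W i j * (W i j)^* <= 1.
Proof.
move=> /unitarymxP WW; have -> : 1 = (W *m W^t*) i i by rewrite WW mxE eqxx.
rewrite mxE (bigD1 j) //= !mxE lerDl sumr_ge0 // => k _.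
by rewrite !mxE mul_conjC_ge0.
Qed.

(** In eigenbases the trace of the product is the sum of [d_i e_j |W_ij|^2] with [W] unitary, to be
    compared termwise with the sum of [d_i e_j]. *)
Lemma psd_trace_mul A B : psd A -> psd B -> 0 <= \tr (A *m B) <= \tr A * \tr B.
Proof.
move=> /psd_spectral[P [d [uP -> d_ge0]]] /psd_spectral[Q [e [uQ -> e_ge0]]].
have trE (M : 'M[C]_N) (x : 'rV[C]_N) : M \is unitarymx ->
    \tr (M^t* *m diag_mx x *m M) = \sum_i x 0 i.
  move=> /unitarymxP hM; rewrite -mulmxA mxtrace_mulC -mulmxA hM mulmx1.
  by apply: eq_bigr => i _; rewrite mxE eqxx mulr1n.
rewrite !trE // mulr_suml.
pose W := P *m Q^t*.
have uW : W \is unitarymx by rewrite mul_unitarymx // trmxC_unitary.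
have -> : \tr (P^t* *m diag_mx d *m P *m (Q^t* *m diag_mx e *m Q)) =
    \sum_i \sum_j d 0 i * e 0 j * (W i j * (W i j)^*).
  rewrite -2!mulmxA mxtrace_mulC.
  have -> : diag_mx d *m (P *m (Q^t* *m diag_mx e *m Q)) *m P^t* =
      diag_mx d *m (W *m diag_mx e *m W^t*).
    by rewrite /W trmx_mul map_mxM trmxCK !mulmxA.
  apply: eq_bigr => i _; rewrite mul_diag_mx !mxE mulr_sumr; apply: eq_bigr => j _.
  by rewrite mul_mx_diag !mxE; ring.
apply/andP; split.
  apply: sumr_ge0 => i _; apply: sumr_ge0 => j _.
  by apply: mulr_ge0; [exact: mulr_ge0 | exact: mul_conjC_ge0].
apply: ler_sum => i _; rewrite mulr_sumr; apply: ler_sum => j _.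
by rewrite ler_piMr ?mulr_ge0 ?unitarymx_normsq_le1.
Qed.

End PsdTrace.

(** * Sums over strings, by code and by length *)

Lemma ler_sum_uniq_subset (R : numDomainType) (I : eqType) (r1 r2 : seq I) (F : I -> R) :
  (forall i, 0 <= F i) -> uniq r1 -> {subset r1 <= r2} ->
  \sum_(i <- r1) F i <= \sum_(i <- r2) F i.
Proof.
move=> F_ge0; elim: r1 r2 => [|x r1 IH] r2 /=.
  by rewrite big_nil sumr_ge0.
move=> /andP[xr1 ur1] sub; have xr2 : x \in r2 by apply: sub; rewrite mem_head.
rewrite big_cons (perm_big _ (perm_to_rem xr2)) big_cons lerD2l; apply: IH => // y yr1.
have : y \in r2 by apply: sub; rewrite inE yr1 orbT.
rewrite (perm_mem (perm_to_rem xr2)) inE => /orP[/eqP yx|//].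
by rewrite -yx yr1 in xr1.
Qed.

Lemma mem_strs_len s : s \in strs_len (size s).
Proof.
elim: s => [|b s IH] //=; rewrite mem_cat.
by case: b; rewrite map_f // orbT.
Qed.

Lemma mem_strs_upto s n : (size s < n)%N -> s \in strs_upto n.
Proof.
move=> sn; apply/flattenP; exists (strs_len (size s)); last exact: mem_strs_len.
by apply: map_f; rewrite mem_iota.
Qed.

Lemma size_str_decode n : (size (str_decode n) <= n)%N.
Proof.
have /andP[h _] := strnum_bounds (str_decode n).
rewrite strnumE str_decodeK in h.
by rewrite -ltnS; apply: leq_trans h; apply: ltn_expl.
Qed.

(** A string with code below [n] has length below [n]. This carries bounds on partial sums ordered
    by length over to the enumeration by code. *)
Lemma sum_str_decode_le (R : numDomainType) (F : seq bool -> R) n :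
  (forall s, 0 <= F s) ->
  \sum_(k < n) F (str_decode k) <= \sum_(s <- strs_upto n) F s.
Proof.
move=> F_ge0.
have -> : \sum_(k < n) F (str_decode k) = \sum_(s <- [seq str_decode k | k <- iota 0 n]) F s.
  by rewrite big_map -(big_mkord xpredT (fun k => F (str_decode k))) /index_iota subn0.
apply: ler_sum_uniq_subset => //.
  by rewrite map_inj_uniq ?iota_uniq //; apply: can_inj str_decodeK.
move=> _ /mapP[k + ->]; rewrite mem_iota /= add0n => kn.
by apply: mem_strs_upto; apply: leq_ltn_trans kn; apply: size_str_decode.
Qed.

(** * Operator norm and diagonal entries *)

Section MatrixEntries.
Variables (R : realType) (N : nat).
Local Notation C := R[i].
Implicit Types (A : 'M[C]_N) (v : 'cV[C]_N).

Lemma vnormsq v : (\sum_i (complex.Re (v i 0) ^+ 2 + complex.Im (v i 0) ^+ 2))%:C%C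
  = \sum_i `|v i 0| ^+ 2.
Proof. by rewrite raddf_sum; apply: eq_bigr => i _; exact: add_Re2_Im2. Qed.

Lemma vnorm1_entry v i : vnorm v = 1 -> `|v i 0| <= 1.
Proof.
move=> v1; rewrite -(@expr_le1 _ 2) //.
have <- : \sum_i `|v i 0| ^+ 2 = 1.
  rewrite -vnormsq; have /(congr1 (fun x => x ^+ 2)) := v1.
  rewrite /vnorm sqr_sqrtr ?expr1n; first by move=> ->.
  by apply: sumr_ge0 => j _; rewrite addr_ge0 ?sqr_ge0.
by rewrite (bigD1 i) //= lerDl; apply: sumr_ge0 => j _; rewrite exprn_ge0.
Qed.

(** Needed for the supremum in [opnorm] to be an upper bound. Entries of a unit vector have modulus
    at most 1, so the absolute row sums of [A] bound the entries of [A *m v]. *)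
Lemma vnorm_mulmx_bounded A :
  has_ubound [set vnorm (A *m v) | v in [set v | vnorm v = 1]]%classic.
Proof.
exists (Num.sqrt (complex.Re (\sum_i (\sum_j `|A i j|) ^+ 2))) => _ [v /= v1 <-].
apply: ler_wsqrtr.
suff : (\sum_i (complex.Re ((A *m v) i 0) ^+ 2 + complex.Im ((A *m v) i 0) ^+ 2))%:C%C
    <= \sum_i (\sum_j `|A i j|) ^+ 2 by rewrite lecE => /andP[].
rewrite vnormsq; apply: ler_sum => i _; rewrite lerXn2r ?nnegrE ?sumr_ge0 //.
rewrite mxE; apply: le_trans (ler_norm_sum _ _ _) _; apply: ler_sum => j _.
by rewrite normrM ler_piMr // vnorm1_entry.
Qed.

Lemma mulmx_delta A i j : (A *m (delta_mx i 0 : 'cV_N)) j 0 = A j i.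
Proof. by rewrite -colE mxE. Qed.

(** Test on the [i]-th basis vector; this turns approximation in operator norm into approximation of
    the diagonal. *)
Lemma Re_diag_le_opnorm A i : `|complex.Re (A i i)| <= opnorm A.
Proof.
have v1 : vnorm (delta_mx i 0 : 'cV[C]_N) = 1.
  rewrite /vnorm (bigD1 i) //= big1 => [|j ji].
    by rewrite !mxE !eqxx /= expr1n expr0n !addr0 sqrtr1.
  by rewrite !mxE (negbTE ji) /= expr0n addr0.
apply: le_trans (ub_le_sup (vnorm_mulmx_bounded A) _); last first.
  by exists (delta_mx i 0).
rewrite /vnorm -sqrtr_sqr; apply: ler_wsqrtr.
rewrite (bigD1 i) //= mulmx_delta -addrA lerDl addr_ge0 ?sqr_ge0 //.
by apply: sumr_ge0 => j _; rewrite addr_ge0 ?sqr_ge0.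
Qed.

Lemma psd_diag_ge0 A i : psd A -> 0 <= A i i.
Proof.
move=> [_ /(_ (delta_mx i 0))].
suff -> : adjmx (delta_mx i 0 : 'cV[C]_N) = delta_mx 0 i.
  by rewrite -rowE -colE !mxE.
apply/matrixP => j k; rewrite !mxE andbC; case: (_ && _) => /=; first exact: conjc1.
exact: conjc0.
Qed.

Lemma psd_Re_diag_ge0 A i : psd A -> 0 <= complex.Re (A i i).
Proof. by move=> /(psd_diag_ge0 i); rewrite lecE => /andP[]. Qed.

Lemma Re_sum (I : Type) (r : seq I) (F : I -> C) :
  complex.Re (\sum_(i <- r) F i) = \sum_(i <- r) complex.Re (F i).
Proof.
elim: r => [|i r IH]; first by rewrite !big_nil.
by rewrite !big_cons -IH; case: (F i) (\sum_(_ <- _) _) => [a b] [c d].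
Qed.

Lemma semiPOVM_diag_sum_le1 (Rm : seq bool -> 'M[C]_N) i n : semiPOVM Rm ->
  \sum_(k < n) complex.Re (Rm (str_decode k) i i) <= 1.
Proof.
move=> [Rm_psd Rm_le].
apply: le_trans (sum_str_decode_le n (fun s => psd_Re_diag_ge0 i (Rm_psd s))) _.
have /(psd_diag_ge0 i) := Rm_le n; rewrite !mxE eqxx subr_ge0 lecE => /andP[_].
by rewrite /partial_sum summxE Re_sum.
Qed.

End MatrixEntries.

(* Truncated subtraction takes the positive part of the approximation [(a - b) / c.+1];
   the summand 2 absorbs both the approximation error and the truncating division. *)
Definition weight (a b c k : nat) : nat := ((a - b) * 2 ^ k) %/ c.+1 + 2.

(** The quotient [q] lies between [r * 2 ^+ k - 2] and [r * 2 ^+ k + 1]: approximation costs one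
    unit either way, rounding down one more below. Since [0 <= r], replacing a negative
    approximation by 0 is harmless. *)
Lemma weight_bounds (R : realFieldType) (r : R) (a b c k : nat) : 0 <= r ->
  `|r - (a%:R - b%:R) / c.+1%:R| < (2 ^+ k)^-1 ->
  r * 2 ^+ k <= (weight a b c k)%:R <= r * 2 ^+ k + 3.
Proof.
move=> r_ge0; set m := (a - b)%N; set q := (m * 2 ^ k %/ c.+1)%N.
have P0 : 0 < 2 ^+ k :> R by rewrite exprn_gt0.
have c0 : 0 < c.+1%:R :> R by rewrite ltr0n.
pose y : R := m%:R * 2 ^+ k / c.+1%:R.
have q_le : q%:R <= y.
  by rewrite ler_pdivlMr // -natrX -!natrM ler_nat leq_trunc_div.
have q_gt : y < q%:R + 1.
  by rewrite ltr_pdivrMr // -natrX natr1 -!natrM ltr_nat ltn_ceil.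
pose g : R := (a%:R - b%:R) / c.+1%:R.
rewrite -/g ltr_norml => /andP[h1 h2].
have e1 : - 1 < (r - g) * 2 ^+ k by rewrite -ltr_pdivrMr // mulN1r.
have e2 : (r - g) * 2 ^+ k < 1 by rewrite -ltr_pdivlMr // mul1r.
have y_ge : g * 2 ^+ k <= y.
  rewrite /y /g mulrAC ler_pM2r ?invr_gt0 // ler_pM2r //.
  rewrite lerBlDr -natrD ler_nat /m; lia.
have y_le : y <= r * 2 ^+ k + 1.
  case: (leqP b a) => ab.
    have -> : y = g * 2 ^+ k by rewrite /y /g /m natrB // mulrAC.
    lra.
  have -> : y = 0 by rewrite /y /m (eqP (ltnW ab)) !mul0r.
  by rewrite addr_ge0 // mulr_ge0 // ltW.
rewrite /weight -/m -/q natrD; apply/andP; split; lra.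
Qed.

(** * The universal bound *)

Lemma sum_half_pow_le2 (R : realFieldType) n : \sum_(m < n) (2 ^+ m)^-1 <= 2 :> R.
Proof.
suff -> : \sum_(m < n) (2 ^+ m)^-1 = 2 - 2 / 2 ^+ n :> R.
  by rewrite lerBlDr lerDl divr_ge0 // exprn_ge0.
elim: n => [|n IH]; first by rewrite big_ord0 expr0 divr1 subrr.
rewrite big_ord_recr /= IH exprS; field.
by rewrite expf_neq0.
Qed.

(** Reduces the condition that all intervals end by 2 to a bound [2 ^+ c] on the sums of
    [A m / 2 ^+ m]. *)
Lemma left_endE (R : realFieldType) (A : nat -> nat) c n :
  (left_end A c n)%:R = 2 ^+ (n + c) * (1 + (\sum_(m < n) (A m)%:R / 2 ^+ m) / 2 ^+ c) :> R.
Proof.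
have P0 k : 2 ^+ k != 0 :> R by rewrite expf_neq0.
elim: n => [|n IH]; first by rewrite big_ord0 mul0r addr0 mulr1 /= natrX.
rewrite /= natrM natrD IH big_ord_recr /= addSn exprS exprD.
by field; rewrite !P0.
Qed.

Section Universal.
Variables (R : realType) (N : nat) (U : seq bool -> option (seq bool)).
Variable Rm : seq bool -> 'M[R[i]]_N.
Hypotheses (N_gt0 : (0 < N)%N) (hU : optimal_computer U).
Hypotheses (hR : semiPOVM Rm) (cR : computable_mx Rm).

Lemma semiPOVM_trace_program : exists d : nat, forall s, exists2 p, U p = Some s &
  complex.Re (\tr (Rm s)) * 2 ^+ size p <= 2 ^+ d.
Proof.
have [G [recG approxG]] := cR.
have [fa ha] := choice (fun i => (recG i i).1).
have [fb hb] := choice ha.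
have [fc hc] := choice hb.
pose r i n := complex.Re (Rm (str_decode n) i i).
(* Precision [2 ^ -n] at the n-th string makes the total error summable. *)
pose A n := (\sum_i weight (fa i n n) (fb i n n) (fc i n n) n)%N.
(* Each of the [N] diagonal entries contributes at most [1 + 3 * 2 = 7] to the sum of
   [A m / 2 ^+ m], and [7 * N < 2 ^ (7 * N)]. *)
pose c := (7 * N)%N.
have r_ge0 i n : 0 <= r i n by apply: psd_Re_diag_ge0; case: hR.
have wB i n : r i n * 2 ^+ n <= (weight (fa i n n) (fb i n n) (fc i n n) n)%:R
    <= r i n * 2 ^+ n + 3.
  apply: weight_bounds => //.
  have [_ _ _ /(_ (str_decode n) n)] := hc i; rewrite str_decodeK => gE.
  apply: le_lt_trans (approxG (str_decode n) n).
  apply: le_trans (Re_diag_le_opnorm _ i).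
  rewrite !mxE /= gE /r; case: (Rm _ i i) => x y /=.
  by rewrite fmorph_div /= rmorphB /= !ratr_nat.
have A_lb n : complex.Re (\tr (Rm (str_decode n))) * 2 ^+ n <= (A n)%:R.
  rewrite Re_sum mulr_suml natr_sum; apply: ler_sum => i _.
  by have /andP[] := wB i n.
have A_ub n : (A n)%:R / 2 ^+ n <= \sum_i (r i n + 3 * (2 ^+ n)^-1).
  rewrite natr_sum mulr_suml; apply: ler_sum => i _.
  rewrite ler_pdivrMr ?exprn_gt0 // mulrDl mulfVK ?expf_neq0 //.
  by have /andP[] := wB i n.
have A_gt0 n : (0 < A n)%N.
  by rewrite /A (bigD1 (Ordinal N_gt0)) //= /weight addn2.
have lA n : (left_end A c n <= 2 ^ (n + c).+1)%N.
  rewrite -(ler_nat R) left_endE natrX exprSr ler_pM2l ?exprn_gt0 //.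
  suff : \sum_(m < n) (A m)%:R / 2 ^+ m <= 2 ^+ c :> R.
    rewrite -[X in _ <= X -> _]mul1r -ler_pdivrMr ?exprn_gt0 //.
    move: (_ / _) => x hx; lra.
  apply: (@le_trans _ _ (7 * N)%N%:R); last first.
    by rewrite -natrX ler_nat ltnW // ltn_expl.
  apply: le_trans (ler_sum _ (fun (m : 'I_n) _ => A_ub m)) _.
  rewrite exchange_big /= mulnC natrM -[N in leRHS]card_ord -sumr_const mulr_suml.
  apply: ler_sum => i _; rewrite big_split /= -mulr_sumr mul1r.
  have := semiPOVM_diag_sum_le1 i n hR; have := sum_half_pow_le2 R n.
  by rewrite /r; move: (\sum_(_ < _) _) (\sum_(_ < _) _) => x y; lra.
have recA : total_recursive 1 (fun v => A (nth 0%N v 0)).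
  apply: total_recursive_sum => i; have [hfa hfb hfc _] := hc i.
  have h0 : total_recursive 1 (fun v => nth 0%N v 0) by apply: total_recursive_nth.
  apply: total_recursive_add; last exact: total_recursive_const.
  apply: total_recursive_div; last exact: total_recursive_recursive2.
  apply: total_recursive_mul; last exact: total_recursive_pow2.
  by apply: total_recursive_sub; apply: total_recursive_recursive2.
have [C hC Cs] := shannon_fano_computer A_gt0 lA recA.
have [sim hsim] := hU.2 C hC.
(* [c] is the scaling of the weights, 2 the factor 4 lost in fitting a dyadic interval, and [sim]
   the cost of passing from [C] to [U]. *)
exists (c + 2 + sim)%N => s; have [p Cp hp] := Cs s.
have [p' [Up' sp']] := hsim _ _ Cp; exists p' => //.
have tr_ge0 : 0 <= complex.Re (\tr (Rm s)).
  by rewrite Re_sum; apply: sumr_ge0 => i _; apply: psd_Re_diag_ge0; case: hR.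
apply: (@le_trans _ _ (complex.Re (\tr (Rm s)) * 2 ^+ size p * 2 ^+ sim)).
  by rewrite -mulrA -exprD ler_wpM2l // ler_eXn2l // ltr1n.
rewrite exprD ler_pM2r ?exprn_gt0 //.
have := A_lb (str_code s); rewrite str_codeK => Alb.
have P0 : 0 < 2 ^+ str_code s :> R by rewrite exprn_gt0.
rewrite -(ler_pM2r P0) mulrAC.
apply: (@le_trans _ _ ((A (str_code s))%:R * 2 ^+ size p)).
  by rewrite ler_pM2r ?exprn_gt0.
rewrite -!natrX -!natrM ler_nat (leq_trans hp) // !expnD; lia.
Qed.

End Universal.

(** * Bounds uniform in the density matrix *)

Lemma density_trace_bounds (R : realType) (N : nat) (rho A : 'M[R[i]]_N) :
  density rho -> psd A ->
  0 <= complex.Re (\tr (rho *m A)) <= complex.Re (\tr A).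
Proof.
move=> [rho_psd rho1] A_psd; have := psd_trace_mul rho_psd A_psd.
by rewrite rho1 mul1r !lecE => /andP[/andP[_ ->] /andP[_ ->]].
Qed.

Theorem mainTheorem1 (R : realType) (N : nat) (hN : (0 < N)%N)
  (U : seq bool -> option (seq bool)) (hU : optimal_computer U)
  (Rm : seq bool -> 'M[R[i]]_N) (hPOVM : POVM Rm) (hcomp : computable_mx Rm) :
  (exists d : nat, forall (rho : 'M[R[i]]_N) (s : seq bool), density rho ->
      (Kc R U s - (d%:R)%:E <= mlog2 (complex.Re (\tr (rho *m Rm s))))%E) /\
  (exists c : R, 0 < c /\ forall (rho : 'M[R[i]]_N) (s : seq bool), density rho ->
      ((complex.Re (\tr (rho *m Rm s)))%:E <= c%:E * Pu R U s)%E).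
Proof.
have [hR _] := hPOVM.
have [d hd] := semiPOVM_trace_program hN hU hR hcomp.
(* [d] was chosen before [rho], which enters only through the bound by the trace of [Rm s]. *)
have core (rho : 'M[R[i]]_N) s : density rho -> exists2 p, U p = Some s &
    complex.Re (\tr (rho *m Rm s)) * 2 ^+ size p <= 2 ^+ d.
  move=> /density_trace_bounds/(_ (hR.1 s))/andP[_ le_tr].
  have [p Up hp] := hd s; exists p => //; apply: le_trans hp.
  by rewrite ler_pM2r ?exprn_gt0.
split.
  exists d => rho s hrho; have [p Up hp] := core rho s hrho.
  have /andP[x_ge0 _] := density_trace_bounds hrho (hR.1 s).
  move: (complex.Re _) x_ge0 hp => x x_ge0 hp.
  rewrite /mlog2; case: eqP => [_|/eqP x_neq0]; first exact: leey.
  have x_gt0 : 0 < x by rewrite lt_def x_neq0.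
  have Kp : (Kc R U s <= (size p)%:R%:E)%E by apply: ereal_inf_lbound; exists p.
  apply: (@le_trans _ _ ((size p)%:R%:E - d%:R%:E)%E); first exact: leeB.
  have ln2_gt0 : 0 < ln 2 :> R by rewrite ln_gt0 // ltr1n.
  rewrite -EFinB lee_fin lerNr -(ler_pM2r ln2_gt0) mulfVK ?gt_eqF //.
  (* Claim (i) is the logarithm of the core inequality, with [K] at most the length of [p]. *)
  have : ln (x * 2 ^+ size p) <= ln (2 ^+ d).
    by rewrite ler_ln ?posrE ?mulr_gt0 ?exprn_gt0.
  rewrite lnM ?posrE ?exprn_gt0 // !lnXn // -[_ *+ size p]mulr_natl -[_ *+ d]mulr_natl; lra.
exists (2 ^+ d); split; first exact: exprn_gt0.
move=> rho s hrho; have [p Up hp] := core rho s hrho.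
(* The single program [p] already contributes enough to [P] for claim (ii). *)
have Pp : (((2 ^+ size p)^-1)%:E <= Pu R U s)%E.
  apply: esum_ge; exists [set p]%classic; last by rewrite fsbig_set1.
  by split; [exact: finite_set1 | move=> _ ->].
apply: (@le_trans _ _ ((2 ^+ d)%:E * ((2 ^+ size p)^-1)%:E)%E).
  by rewrite -EFinM lee_fin ler_pdivlMr ?exprn_gt0.
by apply: lee_wpmul2l => //; rewrite lee_fin exprn_ge0.
Qed.
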